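(* Let $X_Q=V(r^2-qs)\subset\mathbb{C}^4$ (coordinates $(p,q,r,s)$), and for $d\in\mathbb{N}$ let $g_d:X_Q\to X_Q$ be the Chebyshev-induced morphism on $\mathbb{C}^3/D_4\simeq X_Q$. Then $g_d$ is defined over $\mathbb{Z}$, i.e. there are polynomials $P_d,Q_d,R_d,S_d\in\mathbb{Z}[p,q,r,s]$ with $g_d=(P_d,Q_d,R_d,S_d)$ on $X_Q$.
   Context: $\mathbb{N}=\{1,2,\dots\}$. The Chebyshev endomorphism $P_{A_3}^d:\mathbb{C}^3\to\mathbb{C}^3$ is defined by $P_{A_3}^d(e_1(t),e_2(t),e_3(t))=(e_1(t^d),e_2(t^d),e_3(t^d))$ for $t=(t_1,t_2,t_3,t_4)\in(\mathbb{C}^* )^4$ with $t_1t_2t_3t_4=1$, where $t^d=(t_1^d,\dots,t_4^d)$ and $e_j$ is the $j$-th elementary symmetric polynomial. With the linear isomorphism $M_3(x,y,z)=(x+iy,\,z,\,x-iy)$ put $f_d=M_3^{-1}\circ P_{A_3}^d\circ M_3:\mathbb{C}^3\to\mathbb{C}^3$. $D_4\subset GL(3,\mathbb{R})$ is the dihedral group of order 8 generated by $(x,y,z)\mapsto(-y,x,-z)$ and $(x,y,z)\mapsto(x,-y,z)$. The invariant ring $\mathbb{C}[x,y,z]^{D_4}$ is generated by $p=x^2+y^2$, $q=z^2$, $r=z(x^2-y^2)$, $s=(x^2-y^2)^2$, whose ideal of relations is $(r^2-qs)$; the map $\tilde F(x,y,z)=(x^2+y^2,\,z^2,\,z(x^2-y^2),\,(x^2-y^2)^2)$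 from $\mathbb{C}^3$ onto $X_Q$ induces a bijection $\mathbb{C}^3/D_4\simeq X_Q$. Then $g_d:X_Q\to X_Q$ is the unique map with $g_d\circ\tilde F=\tilde F\circ f_d$ (it is a morphism). *)

(* Defs.v *)
From HB Require Import structures.
From mathcomp Require Import all_boot all_order all_algebra.
From mathcomp Require Import reals complex mpoly ring.

Set Implicit Arguments.
Unset Strict Implicit.
Unset Printing Implicit Defensive.

Import Order.TTheory GRing.Theory Num.Theory.
Local Open Scope ring_scope.

(* Affine space C^n is n.-tuple R[i], where R[i] is the field of complex
   numbers over the reals R; v`_k is the k-th coordinate, counted from 0. *)

Definition esym3 (R : realType) (t : 4.-tuple R[i]) : 3.-tuple R[i] :=
  [tuple (mesym 4 R[i] j.+1).@[tnth t] | j < 3].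

Definition powt (R : realType) (d : nat) (t : 4.-tuple R[i]) : 4.-tuple R[i] :=
  [tuple of [seq x ^+ d | x <- t]].

Definition M3 (R : realType) (v : 3.-tuple R[i]) : 3.-tuple R[i] :=
  [tuple v`_0 + 'i%C * v`_1; v`_2; v`_0 - 'i%C * v`_1].

Definition M3inv (R : realType) (w : 3.-tuple R[i]) : 3.-tuple R[i] :=
  [tuple (w`_0 + w`_2) / 2; (w`_0 - w`_2) / (2 * 'i%C); w`_1].

Definition rotD4 (R : realType) (v : 3.-tuple R[i]) : 3.-tuple R[i] :=
  [tuple - v`_1; v`_0; - v`_2].

Definition refD4 (R : realType) (v : 3.-tuple R[i]) : 3.-tuple R[i] :=
  [tuple v`_0; - v`_1; v`_2].

(* The generators have finite order, so closing under them, without their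
   inverses, already gives the orbits of the group D_4. *)
Inductive D4orbit (R : realType) (v : 3.-tuple R[i]) : 3.-tuple R[i] -> Prop :=
| D4orbit_refl : D4orbit v v
| D4orbit_rot w : D4orbit v w -> D4orbit v (rotD4 w)
| D4orbit_ref w : D4orbit v w -> D4orbit v (refD4 w).

(* The coordinates of C^4 are (p, q, r, s) in this order. *)
Definition XQ (R : realType) : Type :=
  {w : 4.-tuple R[i] | w`_2 ^+ 2 - w`_1 * w`_3 == 0}.

Definition invD4 (R : realType) (v : 3.-tuple R[i]) : 4.-tuple R[i] :=
  [tuple v`_0 ^+ 2 + v`_1 ^+ 2; v`_2 ^+ 2; v`_2 * (v`_0 ^+ 2 - v`_1 ^+ 2);
         (v`_0 ^+ 2 - v`_1 ^+ 2) ^+ 2].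

Lemma invD4_XQ (R : realType) (v : 3.-tuple R[i]) :
  (invD4 v)`_2 ^+ 2 - (invD4 v)`_1 * (invD4 v)`_3 == 0.
Proof. by rewrite /= exprMn subrr. Qed.

Definition Ftilde (R : realType) (v : 3.-tuple R[i]) : XQ R :=
  exist _ (invD4 v) (invD4_XQ v).

Section Facts.
Context (R : realType).
Local Notation C := (R[i]).
Implicit Types (t : 4.-tuple C) (v w : 3.-tuple C).

Lemma eq3 v w : v`_0 = w`_0 -> v`_1 = w`_1 -> v`_2 = w`_2 -> v = w.
Proof.
move=> h0 h1 h2; apply: val_inj; apply: (@eq_from_nth _ 0); rewrite ?size_tuple //.
by case=> [|[|[|]]].
Qed.

Lemma sqr_iC : 'i%C * 'i%C = -1 :> C.
Proof. by rewrite -expr2 sqr_i. Qed.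

Lemma iC_neq0 : 'i%C != 0 :> C.
Proof. by apply/eqP=> i0; have /eqP := sqr_iC; rewrite i0 mul0r eq_sym oppr_eq0 oner_eq0. Qed.

Lemma two_neq0 : 2 != 0 :> C.
Proof. by rewrite pnatr_eq0. Qed.

Lemma M3K : cancel (@M3 R) (@M3inv R).
Proof.
by move=> v; apply: eq3 => //=; field; rewrite ?iC_neq0 ?two_neq0.
Qed.

Lemma M3invK : cancel (@M3inv R) (@M3 R).
Proof.
by move=> v; apply: eq3 => //=; field; rewrite ?iC_neq0 ?two_neq0.
Qed.

Lemma mesymE4 t (k : 'I_5) : (mesym 4 C k).@[tnth t] =
  [:: 1; (esym3 t)`_0; (esym3 t)`_1; (esym3 t)`_2; \prod_(x <- t) x]`_k.
Proof.
have H (j : 'I_3) : (esym3 t)`_j = (mesym 4 C j.+1).@[tnth t].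
  by rewrite -(tnth_nth 0) tnth_mktuple.
case: k => [[|[|[|[|[|//]]]]] hk] /=.
- by rewrite mesym0E meval1.
- by rewrite (H (Ordinal (isT : (0 < 3)%N))).
- by rewrite (H (Ordinal (isT : (1 < 3)%N))).
- by rewrite (H (Ordinal (isT : (2 < 3)%N))).
rewrite mesymnnE rmorph_prod /= big_tuple; apply: eq_bigr => i _.
by rewrite mevalXU.
Qed.

Lemma prod_XsubC_coef t (k : 'I_5) :
  (\prod_(x <- t) ('X - x%:P))`_(4 - k) =
  (-1) ^+ k * [:: 1; (esym3 t)`_0; (esym3 t)`_1; (esym3 t)`_2; \prod_(x <- t) x]`_k.
Proof. by rewrite mroots_coeff mesymE4. Qed.

Lemma prod_XsubC_inj t t' : \prod_(x <- t) x = \prod_(x <- t') x ->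
  esym3 t = esym3 t' -> \prod_(x <- t) ('X - x%:P) = \prod_(x <- t') ('X - x%:P).
Proof.
move=> e4 e3; apply/polyP=> k.
have [lk|gk] := ltnP k 5; last first.
  by rewrite !nth_default // size_prod_XsubC size_tuple.
have h : (4 - k < 5)%N by rewrite ltnS leq_subr.
have := prod_XsubC_coef t (Ordinal h); have := prod_XsubC_coef t' (Ordinal h).
by rewrite [X in _`_X]/= subKn // e3 e4 => -> ->.
Qed.

Lemma esym3_perm t t' : perm_eq t t' -> esym3 t = esym3 t'.
Proof.
move=> tt'.
have E : \prod_(x <- t) ('X - x%:P) = \prod_(x <- t') ('X - x%:P) :> {poly C}.
  exact: perm_big.
have F (k : 'I_5) : [:: 1; (esym3 t)`_0; (esym3 t)`_1; (esym3 t)`_2; \prod_(x <- t) x]`_k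
   = [:: 1; (esym3 t')`_0; (esym3 t')`_1; (esym3 t')`_2; \prod_(x <- t') x]`_k.
  have := prod_XsubC_coef t k; rewrite E prod_XsubC_coef => /esym/mulfI; apply.
  by rewrite signr_eq0.
apply: eq3.
- exact: (F (Ordinal (isT : (1 < 5)%N))).
- exact: (F (Ordinal (isT : (2 < 5)%N))).
- exact: (F (Ordinal (isT : (3 < 5)%N))).
Qed.

Lemma esym3_inj t t' : \prod_(x <- t) x = 1 -> \prod_(x <- t') x = 1 ->
  esym3 t = esym3 t' -> perm_eq t t'.
Proof.
by move=> h h' e; apply/prod_XsubC_eq/prod_XsubC_inj => //; rewrite h h'.
Qed.

Lemma esym3_surj v : {t : 4.-tuple C | \prod_(x <- t) x = 1 & esym3 t = v}.
Proof.
pose p : {poly C} := Poly [:: 1; - v`_2; v`_1; - v`_0; 1].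
have sp : polyseq p = [:: 1; - v`_2; v`_1; - v`_0; 1].
  by rewrite (@PolyK _ 0) //= oner_eq0.
have [s] := closed_field_poly_normal p.
rewrite lead_coefE sp /= scale1r => ps.
have szs : size s == 4 by rewrite -eqSS -(size_prod_XsubC s id) -ps sp.
pose t : 4.-tuple C := Tuple szs.
have E (k : 'I_5) :
    [:: 1; (esym3 t)`_0; (esym3 t)`_1; (esym3 t)`_2; \prod_(x <- t) x]`_k =
    (-1) ^+ k * [:: 1; - v`_2; v`_1; - v`_0; 1]`_(4 - k).
  by rewrite -sp ps (prod_XsubC_coef t) signrMK.
exists t.
  by rewrite [LHS](E (Ordinal (isT : (4 < 5)%N))) /=; ring.
apply: eq3.
- by rewrite [LHS](E (Ordinal (isT : (1 < 5)%N))) /=; ring.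
- by rewrite [LHS](E (Ordinal (isT : (2 < 5)%N))) /=; ring.
- by rewrite [LHS](E (Ordinal (isT : (3 < 5)%N))) /=; ring.
Qed.

(* The condition t_1 t_2 t_3 t_4 = 1 already forces every t_i to be nonzero. *)
Lemma chebA3_exists (d : nat) :
  {P : 3.-tuple C -> 3.-tuple C |
    forall t, \prod_(x <- t) x = 1 -> P (esym3 t) = esym3 (powt d t)}.
Proof.
exists (fun v => esym3 (powt d (s2val (esym3_surj v)))) => t ht.
case: (esym3_surj _) => t' ht' /= e.
apply: esym3_perm; apply: perm_map; exact: esym3_inj.
Qed.

Lemma chebA3_unique (d : nat) (P P' : 3.-tuple C -> 3.-tuple C) :
  (forall t, \prod_(x <- t) x = 1 -> P (esym3 t) = esym3 (powt d t)) ->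
  (forall t, \prod_(x <- t) x = 1 -> P' (esym3 t) = esym3 (powt d t)) ->
  P =1 P'.
Proof. by move=> h h' v; have [t ht <-] := esym3_surj v; rewrite h ?h'. Qed.

End Facts.

Definition chebA3 (R : realType) (d : nat) : 3.-tuple R[i] -> 3.-tuple R[i] :=
  sval (chebA3_exists R d).

Definition cheb_f (R : realType) (d : nat) (v : 3.-tuple R[i]) : 3.-tuple R[i] :=
  M3inv (chebA3 d (M3 v)).

Section Quotient.
Context (R : realType) (d : nat).
Local Notation C := (R[i]).
Implicit Types (t : 4.-tuple C) (v w : 3.-tuple C).

Lemma chebA3E t : \prod_(x <- t) x = 1 ->
  chebA3 d (esym3 t) = esym3 (powt d t).
Proof. by rewrite /chebA3; case: (chebA3_exists R d) => P /= hP /hP. Qed.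

Lemma esym3E (a b c e : C) : esym3 [tuple a; b; c; e] =
  [tuple a + b + c + e; a * b + a * c + a * e + b * c + b * e + c * e;
         a * b * c + a * b * e + a * c * e + b * c * e].
Proof.
set t := [tuple a; b; c; e].
pose l := [:: a * b * c * e; - (a * b * c + a * b * e + a * c * e + b * c * e);
  a * b + a * c + a * e + b * c + b * e + c * e; - (a + b + c + e); 1].
have El : \prod_(x <- t) ('X - x%:P) = Poly l.
  rewrite !big_cons big_nil /= !cons_poly_def.
  by rewrite !(rmorphD, rmorphN, rmorphM, rmorph1) /= ; ring.
have E (k : 'I_5) :
    [:: 1; (esym3 t)`_0; (esym3 t)`_1; (esym3 t)`_2; \prod_(x <- t) x]`_k =
    (-1) ^+ k * l`_(4 - k).
  by rewrite -(coef_Poly l) -El prod_XsubC_coef signrMK.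
apply: eq3.
- by rewrite [LHS](E (Ordinal (isT : (1 < 5)%N))) /=; ring.
- by rewrite [LHS](E (Ordinal (isT : (2 < 5)%N))) /=; ring.
- by rewrite [LHS](E (Ordinal (isT : (3 < 5)%N))) /=; ring.
Qed.

Lemma tuple4P t : exists a b c e, t = [tuple a; b; c; e].
Proof.
case: t => [[|a [|b [|c [|e [|]]]]] ht] //.
by exists a, b, c, e; apply: val_inj.
Qed.

Lemma prod4 (a b c e : C) : \prod_(x <- [tuple a; b; c; e]) x = a * b * c * e.
Proof. by rewrite !big_cons big_nil /= mulr1 !mulrA. Qed.

Lemma powt4 (a b c e : C) :
  powt d [tuple a; b; c; e] = [tuple a ^+ d; b ^+ d; c ^+ d; e ^+ d].
Proof. exact: val_inj. Qed.

Definition scale3 (a : C) w : 3.-tuple C :=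
  [tuple a * w`_0; a ^+ 2 * w`_1; a ^+ 3 * w`_2].

Definition flip3 w : 3.-tuple C := [tuple w`_2; w`_1; w`_0].

Lemma chebA3_scale w (k : C) : k ^+ 4 = 1 ->
  chebA3 d (scale3 k w) = scale3 (k ^+ d) (chebA3 d w).
Proof.
move=> k4; have [t ht <-] := esym3_surj w; rewrite (chebA3E ht).
have [a [b [c [e]]]] := tuple4P t; move=> tE; move: ht; rewrite {t}tE prod4 => ht.
have -> : scale3 k (esym3 [tuple a; b; c; e]) =
          esym3 [tuple k * a; k * b; k * c; k * e].
  by rewrite !esym3E; apply: eq3 => /=; ring.
rewrite chebA3E; last first.
  rewrite prod4; transitivity (k ^+ 4 * (a * b * c * e)); first by ring.
  by rewrite k4 ht mul1r.
by rewrite !powt4 !esym3E !exprMn; apply: eq3 => /=; ring.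
Qed.

Lemma chebA3_flip w : chebA3 d (flip3 w) = flip3 (chebA3 d w).
Proof.
have [t ht <-] := esym3_surj w; rewrite (chebA3E ht).
have [a [b [c [e]]]] := tuple4P t; move=> tE; move: ht; rewrite {t}tE prod4 => ht.
have flipE (a' b' c' e' : C) : a' * b' * c' * e' = 1 ->
    flip3 (esym3 [tuple a'; b'; c'; e']) =
    esym3 [tuple b' * c' * e'; a' * c' * e'; a' * b' * e'; a' * b' * c'].
  move=> h; rewrite !esym3E; apply: eq3 => /=; first by ring.
    rewrite -[LHS]mul1r -{1}h; ring.
  by rewrite -[LHS]mul1r -{1}(mulr1 1) -{1}h -{1}h; ring.
rewrite flipE // chebA3E; last first.
  rewrite prod4; transitivity ((a * b * c * e) ^+ 3); first by ring.
  by rewrite ht expr1n.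
rewrite !powt4 !exprMn -flipE //.
by rewrite -!exprMn ht expr1n.
Qed.

Lemma cheb_f_ref v : cheb_f d (refD4 v) = refD4 (cheb_f d v).
Proof.
rewrite /cheb_f.
have -> : M3 (refD4 v) = flip3 (M3 v) by apply: eq3 => /=; ring.
rewrite chebA3_flip.
by apply: eq3 => //=; field; rewrite ?iC_neq0 ?two_neq0.
Qed.

Lemma cheb_f_rot v : cheb_f d (rotD4 v) = iter d (@rotD4 R) (cheb_f d v).
Proof.
have iC2 := sqr_iC R.
have M3rot u : M3 (rotD4 u) = scale3 'i%C (M3 u).
  by apply: eq3 => /=; rewrite ?exprS ?expr0; ring: iC2.
rewrite /cheb_f M3rot chebA3_scale; last by rewrite !exprS expr0; ring: iC2.
move: (chebA3 d (M3 v)) => w.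
elim: (d) => [|n IHn] /=.
  by congr M3inv; apply: eq3 => /=; rewrite ?expr0 ?expr1n ?mul1r.
rewrite -IHn; rewrite -[RHS]M3K M3rot M3invK; congr M3inv.
by apply: eq3 => /=; rewrite !exprS; ring.
Qed.

Lemma Ftilde_inj v w : invD4 v = invD4 w -> Ftilde v = Ftilde w.
Proof. by move=> h; apply: val_inj. Qed.

Lemma eq4 (u u' : 4.-tuple C) :
  u`_0 = u'`_0 -> u`_1 = u'`_1 -> u`_2 = u'`_2 -> u`_3 = u'`_3 -> u = u'.
Proof.
move=> h0 h1 h2 h3; apply: val_inj; apply: (@eq_from_nth _ 0); rewrite ?size_tuple //.
by case=> [|[|[|[|]]]].
Qed.

Lemma Ftilde_rot v : Ftilde (rotD4 v) = Ftilde v.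
Proof. by apply/Ftilde_inj/eq4 => /=; ring. Qed.

Lemma Ftilde_ref v : Ftilde (refD4 v) = Ftilde v.
Proof. by apply/Ftilde_inj/eq4 => /=; ring. Qed.

Lemma Ftilde_surj (u : XQ R) : {v | Ftilde v = u}.
Proof.
case: u => u hu; pose z := sqrtC u`_1.
have zz : z ^+ 2 = u`_1 by rewrite sqrtCK.
have [m mm zm] : {m : C | m ^+ 2 = u`_3 & z * m = u`_2}.
  pose m := sqrtC u`_3; have mm : m ^+ 2 = u`_3 by rewrite sqrtCK.
  have : (z * m == u`_2) || (z * m == - u`_2).
    by rewrite -eqf_sqr exprMn zz mm eq_sym -subr_eq0.
  have [h _|_ /= h] := eqVneq (z * m) u`_2; first by exists m.
  by exists (- m); rewrite ?sqrrN // mulrN (eqP h) opprK.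
exists [tuple sqrtC ((u`_0 + m) / 2); sqrtC ((u`_0 - m) / 2); z].
apply: val_inj; apply: eq4 => /=; rewrite ?sqrtCK //.
- by field; rewrite ?two_neq0.
- by rewrite -zm; field; rewrite ?two_neq0.
- by rewrite -mm; field; rewrite ?two_neq0.
Qed.

Lemma Ftilde_orbit v w : Ftilde v = Ftilde w <-> D4orbit v w.
Proof.
split; last first.
  by elim=> // {}w _ ->; rewrite ?Ftilde_rot ?Ftilde_ref.
move/(congr1 val) => /= E.
have /= hp := congr1 (fun u : 4.-tuple C => u`_0) E.
have /= hq := congr1 (fun u : 4.-tuple C => u`_1) E.
have /= hr := congr1 (fun u : 4.-tuple C => u`_2) E.
have /= hs := congr1 (fun u : 4.-tuple C => u`_3) E.
have O1 a b c : D4orbit v [tuple a; b; c] -> D4orbit v [tuple a; - b; c].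
  move=> h; suff -> : [tuple a; - b; c] = refD4 [tuple a; b; c] by constructor.
  exact: eq3.
have O2 a b c : D4orbit v [tuple a; b; c] -> D4orbit v [tuple b; a; - c].
  move=> h; suff -> : [tuple b; a; - c] = rotD4 (refD4 [tuple a; b; c]).
    by do 2!constructor.
  by apply: eq3 => //=; rewrite opprK.
have O3 a b c : D4orbit v [tuple a; b; c] -> D4orbit v [tuple - a; b; c].
  by move=> /O2/O1/O2; rewrite opprK.
have O0 : D4orbit v [tuple v`_0; v`_1; v`_2].
  by have <- : v = [tuple v`_0; v`_1; v`_2] by [exact: eq3|]; constructor.
have -> : w = [tuple w`_0; w`_1; w`_2] by exact: eq3.
move: (v`_0) (v`_1) (v`_2) (w`_0) (w`_1) (w`_2) hp hq hr hs O0.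
move=> x y z x' y' z' hp hq hr hs O0.
have sg (a b : C) : a ^+ 2 = b ^+ 2 -> (b = a) \/ (b = - a).
  by move=> /eqP; rewrite eq_sym eqf_sqr => /orP[] /eqP; [left|right].
have [[zz hm]|[zz hm]] : (z' = z /\ x ^+ 2 - y ^+ 2 = x' ^+ 2 - y' ^+ 2) \/
      (z' = - z /\ x ^+ 2 - y ^+ 2 = - (x' ^+ 2 - y' ^+ 2)).
  have [z0|z0] := eqVneq z 0.
    have z'0 : z' = 0 by apply/eqP; rewrite -sqrf_eq0 -hq z0 expr0n.
    rewrite z0 z'0 oppr0; have [->|->] := sg _ _ hs; first by left.
    by right; rewrite opprK.
  have [zz|zz] := sg _ _ hq; [left|right]; split => //.
    by apply: (mulfI z0); rewrite hr zz.
  by apply: (mulfI z0); rewrite hr zz mulNr mulrN.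
  have hx : x ^+ 2 = x' ^+ 2.
    apply: (mulfI (two_neq0 R)).
    transitivity ((x ^+ 2 + y ^+ 2) + (x ^+ 2 - y ^+ 2)); first by ring.
    by rewrite hp hm; ring.
  have hy : y ^+ 2 = y' ^+ 2.
    apply: (mulfI (two_neq0 R)).
    transitivity ((x ^+ 2 + y ^+ 2) - (x ^+ 2 - y ^+ 2)); first by ring.
    by rewrite hp hm; ring.
  by rewrite zz; have [->|->] := sg _ _ hx; have [->|->] := sg _ _ hy; auto.
have hx : x ^+ 2 = y' ^+ 2.
  apply: (mulfI (two_neq0 R)).
    transitivity ((x ^+ 2 + y ^+ 2) + (x ^+ 2 - y ^+ 2)); first by ring.
    by rewrite hp hm; ring.
have hy : y ^+ 2 = x' ^+ 2.
  apply: (mulfI (two_neq0 R)).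
    transitivity ((x ^+ 2 + y ^+ 2) - (x ^+ 2 - y ^+ 2)); first by ring.
    by rewrite hp hm; ring.
by rewrite zz; have [->|->] := sg _ _ hx; have [->|->] := sg _ _ hy; auto.
Qed.

Lemma cheb_f_orbit v w : D4orbit v w -> Ftilde (cheb_f d v) = Ftilde (cheb_f d w).
Proof.
elim=> // {}w _ ->; last by rewrite cheb_f_ref Ftilde_ref.
rewrite cheb_f_rot; elim: (d) (cheb_f _ w) => //= n IHn u.
by rewrite Ftilde_rot.
Qed.

Lemma cheb_g_exists :
  {g : XQ R -> XQ R | forall v, g (Ftilde v) = Ftilde (cheb_f d v)}.
Proof.
exists (fun u => Ftilde (cheb_f d (sval (Ftilde_surj u)))) => v.
case: (Ftilde_surj _) => v' /= /Ftilde_orbit; exact: cheb_f_orbit.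
Qed.

Lemma cheb_g_unique (g g' : XQ R -> XQ R) :
  (forall v, g (Ftilde v) = Ftilde (cheb_f d v)) ->
  (forall v, g' (Ftilde v) = Ftilde (cheb_f d v)) -> g =1 g'.
Proof. by move=> h h' u; have [v <-] := Ftilde_surj u; rewrite h h'. Qed.

End Quotient.

Definition cheb_g (R : realType) (d : nat) : XQ R -> XQ R :=
  sval (cheb_g_exists R d).

Definition evalZ (R : realType) (P : {mpoly int[4]}) (w : 4.-tuple R[i]) : R[i] :=
  (map_mpoly intr P).@[tnth w].

(* Main.v *)
(* Put z = w_1, p = w_0 w_2 and m = (w_0^2 + w_2^2) / 2 in the coordinates
   w = M3(v), so that q = z^2, r = z m, s = m^2, and let L = Z[p, q, r, s].
   Since m^2, m z and z^2 lie in L, L + (m L + z L) is a ring graded by Z/2.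
   Write (A, B, A') for the components of the Chebyshev map; A' is the image of A
   under the exchange of w_0 and w_2. Then g_d = (A A', B^2, B M, M^2) with
   M = (A^2 + A'^2) / 2, so it suffices that A A' is in L and that B and M both
   have degree d mod 2. For B this follows from its linear recurrence, whose
   coefficients are homogeneous. A is an integral combination of monomials
   of weight d mod 4 (the w_i having weights 1, 2, 3): in A A' and M the cross
   terms are integral traces, and the half-traces of squares of monomials reduce
   to (w_0^2n + w_2^2n) / 2, which satisfy a recurrence with integral coefficients. *)
Require Import Defs.
From mathcomp Require Import all_boot all_order all_algebra.
From mathcomp Require Import reals complex mpoly.
From mathcomp Require Import ring zify.
Import GRing.Theory.
Local Open Scope ring_scope.

Set Implicit Arguments.
Unset Strict Implicit.

Section Semiinvariants.
Context (R : realType).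
Local Notation C := (R[i]).
Local Notation V := (3.-tuple C).
Implicit Types (F G H : V -> C) (w : V).

(** * The invariants of D_4 in the coordinates w = M3(v) *)

Definition half_tr w : C := (w`_0 ^+ 2 + w`_2 ^+ 2) / 2.

Definition invM3 w : 4.-tuple C :=
  [tuple w`_0 * w`_2; w`_1 ^+ 2; w`_1 * half_tr w; half_tr w ^+ 2].

(** For w_0 = x + i y and w_2 = x - i y the imaginary parts cancel in w_0^2 + w_2^2 = 2 (x^2 - y^2),
    so [half_tr] is the factor x^2 - y^2 of r and s. *)
Lemma invM3_M3 (v : V) : invM3 (M3 v) = invD4 v.
Proof.
have iC2 := sqr_iC R.
have hm : half_tr (M3 v) = v`_0 ^+ 2 - v`_1 ^+ 2.
  rewrite /half_tr /=; transitivity (v`_0 ^+ 2 + ('i%C * 'i%C) * v`_1 ^+ 2).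
    by field; rewrite ?two_neq0.
  by rewrite iC2; ring.
by apply: eq4; rewrite /= -?/(half_tr (M3 v)) ?hm //=; ring: iC2.
Qed.

Lemma invD4_M3inv w : invD4 (M3inv w) = invM3 w.
Proof. by rewrite -invM3_M3 M3invK. Qed.

(** * The ring of integral invariants and its Z/2-graded extension *)

Lemma evalZD P Q (u : 4.-tuple C) : evalZ (P + Q) u = evalZ P u + evalZ Q u.
Proof. by rewrite /evalZ !rmorphD. Qed.

Lemma evalZM P Q (u : 4.-tuple C) : evalZ (P * Q) u = evalZ P u * evalZ Q u.
Proof. by rewrite /evalZ !rmorphM. Qed.

Lemma evalZ_int (n : int) (u : 4.-tuple C) : evalZ n%:~R u = n%:~R.
Proof. by rewrite /evalZ !rmorph_int. Qed.

Lemma evalZX (i : 'I_4) (u : 4.-tuple C) : evalZ 'X_i u = u`_i.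
Proof. by rewrite /evalZ map_mpolyX mevalXU (tnth_nth 0). Qed.

Definition integral_inv F := exists P, forall w, F w = evalZ P (invM3 w).

(* The integral forms of the two parts of C[x, y, z] on which rotD4 acts by 1
   and by -1, respectively, and which are fixed by refD4. *)
Definition semi_inv (b : bool) F :=
  if b then
    exists G H, [/\ integral_inv G, integral_inv H &
      forall w, F w = half_tr w * G w + w`_1 * H w]
  else integral_inv F.

Lemma eq_integral_inv F G : F =1 G -> integral_inv F -> integral_inv G.
Proof. by move=> FG [P hP]; exists P => w; rewrite -FG. Qed.

Lemma eq_semi_inv b F G : F =1 G -> semi_inv b F -> semi_inv b G.
Proof.
case: b => /= FG; last exact: eq_integral_inv.
by case=> [K [L [hK hL FE]]]; exists K, L; split=> // w; rewrite -FG.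
Qed.

Lemma integral_invD F G :
  integral_inv F -> integral_inv G -> integral_inv (fun w => F w + G w).
Proof.
by move=> [P hP] [Q hQ]; exists (P + Q) => w; rewrite evalZD hP hQ.
Qed.

Lemma integral_invM F G :
  integral_inv F -> integral_inv G -> integral_inv (fun w => F w * G w).
Proof.
by move=> [P hP] [Q hQ]; exists (P * Q) => w; rewrite evalZM hP hQ.
Qed.

Lemma integral_inv_int (n : int) : integral_inv (fun=> n%:~R).
Proof. by exists n%:~R => w; rewrite evalZ_int. Qed.

Lemma integral_inv_coord (i : 'I_4) : integral_inv (fun w => (invM3 w)`_i).
Proof. by exists 'X_i => w; rewrite evalZX. Qed.

Lemma semi_invD b F G :
  semi_inv b F -> semi_inv b G -> semi_inv b (fun w => F w + G w).
Proof.
case: b => /=; last exact: integral_invD.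
move=> [K [L [hK hL FE]]] [K' [L' [hK' hL' GE]]].
exists (fun w => K w + K' w), (fun w => L w + L' w).
by split; [exact: integral_invD..|move=> w; rewrite FE GE; ring].
Qed.

Lemma semi_inv_int (n : int) : semi_inv false (fun=> n%:~R).
Proof. exact: integral_inv_int. Qed.

Lemma semi_inv_p : semi_inv false (fun w => w`_0 * w`_2).
Proof. exact: integral_inv_coord (Ordinal (isT : 0 < 4)%N). Qed.

Lemma semi_inv_m : semi_inv true half_tr.
Proof.
exists (fun=> 1%:~R), (fun=> 0%:~R).
by split; [exact: integral_inv_int..|move=> w; rewrite mulr1 mulr0 addr0].
Qed.

Lemma semi_inv_z : semi_inv true (fun w => w`_1).
Proof.
exists (fun=> 0%:~R), (fun=> 1%:~R).
by split; [exact: integral_inv_int..|move=> w; rewrite mulr1 mulr0 add0r].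
Qed.

Lemma semi_invM b c F G :
  semi_inv b F -> semi_inv c G -> semi_inv (b (+) c) (fun w => F w * G w).
Proof.
(* These coordinates are z^2, z m and m^2, the products that bring odd times odd back to the even
   part. *)
have q1 := integral_inv_coord (Ordinal (isT : 1 < 4)%N).
have q2 := integral_inv_coord (Ordinal (isT : 2 < 4)%N).
have q3 := integral_inv_coord (Ordinal (isT : 3 < 4)%N).
case: b c => [] [] /=; last exact: integral_invM.
- move=> [K [L [hK hL FE]]] [K' [L' [hK' hL' GE]]].
  have h := integral_invD (integral_invD
    (integral_invM q3 (integral_invM hK hK'))
    (integral_invM q2 (integral_invD (integral_invM hK hL') (integral_invM hL hK'))))
    (integral_invM q1 (integral_invM hL hL')).
  by apply: eq_integral_inv h => w; rewrite FE GE /=; ring.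
- move=> [K [L [hK hL FE]]] hG.
  exists (fun w => K w * G w), (fun w => L w * G w).
  by split; [exact: integral_invM..|move=> w; rewrite FE; ring].
move=> hF [K [L [hK hL GE]]].
exists (fun w => F w * K w), (fun w => F w * L w).
by split; [exact: integral_invM..|move=> w; rewrite GE; ring].
Qed.

Lemma semi_invZ (n : int) b F : semi_inv b F -> semi_inv b (fun w => n%:~R * F w).
Proof. by move/(semi_invM (semi_inv_int n)). Qed.

Lemma semi_inv0 s : semi_inv s (fun=> 0).
Proof.
case: s; last exact: semi_inv_int 0.
by apply: eq_semi_inv (semi_invZ 0 semi_inv_m) => w; rewrite mul0r.
Qed.

Lemma semi_invN b F : semi_inv b F -> semi_inv b (fun w => - F w).
Proof. by move/(semi_invZ (-1)); apply: eq_semi_inv => w; rewrite mulN1r. Qed.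

Lemma semi_invX b F n : semi_inv b F -> semi_inv (b && odd n) (fun w => F w ^+ n).
Proof.
move=> hF; elim: n => [|n IHn]; first by rewrite andbF; exact: semi_inv_int 1.
have := semi_invM hF IHn; have -> : b (+) b && odd n = b && odd n.+1.
  by case: b {hF IHn} => //=; rewrite addTb.
by apply: eq_semi_inv => w; rewrite exprS.
Qed.

(* Half of the power sums satisfies the recurrence of Chebyshev polynomials,
   h_(n+2) = 2 m h_(n+1) - p^2 h_n, hence the factor 1/2 costs no integrality. *)
Lemma semi_inv_half_pow n :
  semi_inv (odd n) (fun w => (w`_0 ^+ n.*2 + w`_2 ^+ n.*2) / 2).
Proof.
suff: semi_inv (odd n) (fun w => (w`_0 ^+ n.*2 + w`_2 ^+ n.*2) / 2) /\
      semi_inv (~~ odd n) (fun w => (w`_0 ^+ n.+1.*2 + w`_2 ^+ n.+1.*2) / 2).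
  by case.
elim: n => [|n [IH0 IH1]].
  split; last exact: semi_inv_m.
  by apply: eq_semi_inv (semi_inv_int 1) => w; rewrite !expr0 divff ?two_neq0.
split=> //=; rewrite negbK.
have h1 := semi_invZ 2 (semi_invM semi_inv_m IH1).
have h2 := semi_invN (semi_invM (semi_invX 2 semi_inv_p) IH0).
rewrite addTb negbK in h1.
apply: eq_semi_inv (semi_invD h1 h2) => w /=.
by rewrite /half_tr !doubleS !exprS; field.
Qed.

(** * Traces and norms of integral combinations of monomials *)

Definition monom a b c w : C := w`_0 ^+ a * w`_1 ^+ b * w`_2 ^+ c.

Lemma monomM a b c a' b' c' w :
  monom a b c w * monom a' b' c' w = monom (a + a')%N (b + b')%N (c + c')%N w.
Proof. by rewrite /monom !exprD; ring. Qed.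

Lemma monom_flip a b c w : monom a b c (flip3 w) = monom c b a w.
Proof. by rewrite /monom /=; ring. Qed.

(** By symmetry under the flip, c <= a. As 3 c = -c mod 4, the congruence makes a - c an even number
    2 k with k + b = n mod 2, and the half-trace is p^c z^b (w_0^(2k) + w_2^(2k)) / 2. *)
Lemma semi_inv_half_monom n a b c : (a + b.*2 + 3 * c = n.*2 %[mod 4])%N ->
  semi_inv (odd n) (fun w => (monom a b c w + monom a b c (flip3 w)) / 2).
Proof.
wlog ca : a c / (c <= a)%N => [hw|hn].
  have [/hw//|/ltnW ac hn] := leqP c a.
  apply: eq_semi_inv (hw c a ac _) => [w|]; last by lia.
  by rewrite !monom_flip addrC.
have [k ak] : exists k, (a = c + k.*2)%N by exists (a - c)./2; lia.
have := semi_invM (semi_invM (semi_invX c semi_inv_p) (semi_invX b semi_inv_z))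
                  (semi_inv_half_pow k).
rewrite andFb addFb andTb -oddD.
have -> : odd (b + k) = odd n by lia.
apply: eq_semi_inv => w; rewrite monom_flip /monom ak exprMn !exprD.
by ring.
Qed.

(** The weight mod 4 is the character of [scale3] at i, that is, of the rotation in D_4. Adding one
    monomial at a time lets quadratic expressions be treated by induction; the pointwise equations
    avoid function extensionality. *)
Inductive graded (n : nat) : (V -> C) -> Prop :=
| graded0 F : (forall w, F w = 0) -> graded n F
| gradedS F G a b c (k : int) : (a + b.*2 + 3 * c = n %[mod 4])%N ->
    graded n F -> (forall w, G w = k%:~R * monom a b c w + F w) -> graded n G.

Lemma eq_graded n F G : F =1 G -> graded n F -> graded n G.
Proof.
move=> FG hF; case: hF FG => [{}F F0|{}F K a b c k habc hF KE] FG.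
  by apply: graded0 => w; rewrite -FG.
by apply: gradedS habc hF _ => w; rewrite -FG.
Qed.

Lemma eq_mod_graded n n' F : (n = n' %[mod 4])%N -> graded n F -> graded n' F.
Proof.
move=> nn'; elim=> [{}F F0|{}F G a b c k habc _ IH GE]; first exact: graded0.
by apply: gradedS IH GE; rewrite habc.
Qed.

Lemma gradedD n F G : graded n F -> graded n G -> graded n (fun w => F w + G w).
Proof.
move=> hF hG; elim: hF => [{}F F0|{}F K a b c k habc _ IH KE].
  by apply: eq_graded hG => w; rewrite F0 add0r.
by apply: gradedS habc IH _ => w; rewrite KE addrA.
Qed.

Lemma gradedM_monom n m F a b c (k : int) : (a + b.*2 + 3 * c = m %[mod 4])%N ->
  graded n F -> graded (n + m)%N (fun w => k%:~R * monom a b c w * F w).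
Proof.
move=> hm; elim=> [{}F F0|{}F G a' b' c' k' habc _ IH GE].
  by apply: graded0 => w; rewrite F0 mulr0.
apply: (@gradedS _ _ _ (a + a')%N (b + b')%N (c + c')%N (k * k') _ IH); first by lia.
by move=> w; rewrite GE -monomM intrM; ring.
Qed.

(** The flip negates weights mod 4; 3 n stands for -n within the natural numbers. *)
Lemma graded_flip n F : graded n F -> graded (3 * n)%N (fun w => F (flip3 w)).
Proof.
elim=> [{}F F0|{}F G a b c k habc _ IH GE]; first by apply: graded0 => w.
apply: (@gradedS _ _ _ c b a k _ IH); first by lia.
by move=> w; rewrite GE monom_flip.
Qed.

(** The trace of a monomial of even weight is twice its half-trace. This serves for the cross terms
    of norms and squares. *)
Lemma graded_tr n F : graded n.*2 F ->
  semi_inv (odd n) (fun w => F w + F (flip3 w)).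
Proof.
elim=> [{}F F0|{}F G a b c k habc _ IH GE].
  by apply: eq_semi_inv (semi_inv0 _) => w; rewrite !F0 addr0.
apply: eq_semi_inv (semi_invD (semi_invZ (2 * k) (semi_inv_half_monom habc)) IH) => w.
by rewrite !GE intrM; field.
Qed.

Lemma flip3K : cancel (@flip3 R) (@flip3 R).
Proof. by move=> w; apply: eq3. Qed.

Lemma semi_inv_monom_norm a b c :
  semi_inv false (fun w => monom a b c w * monom a b c (flip3 w)).
Proof.
have := semi_invM (semi_invX (a + c)%N semi_inv_p) (semi_invX b (semi_invX 2 semi_inv_z)).
apply: eq_semi_inv => w; rewrite monom_flip /monom exprMn !exprD.
by rewrite -exprM mulnC exprM; ring.
Qed.

(** When a term x is added to F, the norm gains the norm of x and the trace of x times the flip of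
    F. That product has weight n + 3 n = 0 mod 4, so its trace lies in the even part. *)
Lemma graded_norm n F : graded n F -> semi_inv false (fun w => F w * F (flip3 w)).
Proof.
elim=> [{}F F0|{}F G a b c k habc hF IH GE].
  by apply: eq_semi_inv (semi_inv_int 0) => w; rewrite F0 mul0r.
have hx : graded (n + n).*2%N (fun w => k%:~R * monom a b c w * F (flip3 w)).
  apply: eq_mod_graded (gradedM_monom k habc (graded_flip hF)).
  by lia.
have htr := graded_tr hx; rewrite oddD addbb in htr.
have h := semi_invD (semi_invD IH (semi_invZ (k * k) (semi_inv_monom_norm a b c))) htr.
apply: eq_semi_inv h => w.
by rewrite !GE flip3K intrM; ring.
Qed.

(** The cross term 2 x F of (x + F)^2 cancels the denominator and leaves a full trace; only squares
    of monomials need half-traces. *)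
Lemma graded_half_sqr n F : graded n F ->
  semi_inv (odd n) (fun w => (F w ^+ 2 + F (flip3 w) ^+ 2) / 2).
Proof.
elim=> [{}F F0|{}F G a b c k habc hF IH GE].
  by apply: eq_semi_inv (semi_inv0 _) => w; rewrite !F0 expr0n /= addr0 mul0r.
have hx : graded n.*2 (fun w => k%:~R * monom a b c w * F w).
  apply: eq_mod_graded (gradedM_monom k habc hF).
  by rewrite addnn.
have h2 : semi_inv (odd n)
    (fun w => (monom (a + a)%N (b + b)%N (c + c)%N w
               + monom (a + a)%N (b + b)%N (c + c)%N (flip3 w)) / 2).
  by apply: semi_inv_half_monom; lia.
have h := semi_invD (semi_invD IH (semi_invZ (k * k) h2)) (graded_tr hx).
apply: eq_semi_inv h => w.
by rewrite !GE -!monomM intrM; field.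
Qed.

(** * Recurrences for the components of the Chebyshev map *)

Definition chebA n w : C := (chebA3 n w)`_0.
Definition chebB n w : C := (chebA3 n w)`_1.

Lemma chebA_flip n w : chebA n (flip3 w) = (chebA3 n w)`_2.
Proof. by rewrite /chebA chebA3_flip. Qed.

Lemma esym3_surj4 w : exists a b c e,
  [/\ a * b * c * e = 1, w = esym3 [tuple a; b; c; e] &
      forall n, chebA3 n w = esym3 [tuple a ^+ n; b ^+ n; c ^+ n; e ^+ n]].
Proof.
have [t ht <-] := esym3_surj w; have [a [b [c [e tE]]]] := tuple4P t.
exists a, b, c, e; rewrite -prod4 -tE; split=> // n.
by rewrite chebA3E // tE powt4.
Qed.

Lemma chebA_init w : [/\ chebA 0 w = 4, chebA 1 w = w`_0,
  chebA 2 w = w`_0 ^+ 2 - 2 * w`_1 &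
  chebA 3 w = w`_0 ^+ 3 - 3 * w`_0 * w`_1 + 3 * w`_2].
Proof.
have [a [b [c [e [h -> AE]]]]] := esym3_surj4 w.
by rewrite /chebA !AE !esym3E /=; split; ring.
Qed.

(** [chebA n] is the n-th power sum of the roots of X^4 - w_0 X^3 + w_1 X^2 - w_2 X + 1. *)
Lemma chebA_rec n w : chebA n.+4 w =
  w`_0 * chebA n.+3 w - w`_1 * chebA n.+2 w + w`_2 * chebA n.+1 w - chebA n w.
Proof.
have [a [b [c [e [h -> AE]]]]] := esym3_surj4 w.
(* The last term is multiplied by 1 = a b c e, which turns the claim into a polynomial identity. *)
rewrite /chebA !AE !esym3E /= -[X in _ - X]mul1r -[in X in _ - X]h !exprS.
by ring.
Qed.

Definition pair_e2 w : C := w`_0 * w`_2 - 1.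
Definition pair_e3 w : C := w`_0 ^+ 2 + w`_2 ^+ 2 - 2 * w`_1.

(* [chebB n] is the n-th power sum of the six products t_i t_j, i < j. Since
   t_1 t_2 t_3 t_4 = 1 these come in inverse pairs, so their elementary symmetric
   polynomials are the palindrome 1, z, pair_e2, pair_e3, pair_e2, z, 1. *)
Lemma chebB_init w :
  [/\ chebB 0 w = 6, chebB 1 w = w`_1,
   chebB 2 w = w`_1 * chebB 1 w - pair_e2 w * 2 &
   [/\ chebB 3 w = w`_1 * chebB 2 w - pair_e2 w * chebB 1 w + pair_e3 w * 3,
   chebB 4 w = w`_1 * chebB 3 w - pair_e2 w * chebB 2 w + pair_e3 w * chebB 1 w
               - pair_e2 w * 4 &
   chebB 5 w = w`_1 * chebB 4 w - pair_e2 w * chebB 3 w + pair_e3 w * chebB 2 w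
               - pair_e2 w * chebB 1 w + w`_1 * 5]].
Proof.
have [a [b [c [e [h -> AE]]]]] := esym3_surj4 w.
rewrite /chebB /pair_e2 /pair_e3 !AE !esym3E /= {w AE}.
by split; last split; ring: h.
Qed.

(** Since w is symmetric in a, b, c, e, the root a b stands for all six products in [chebB_rec]. *)
Lemma pair_root (a b c e : C) : a * b * c * e = 1 ->
  let w := esym3 [tuple a; b; c; e] in let u := a * b in
  u ^+ 6 = w`_1 * u ^+ 5 - pair_e2 w * u ^+ 4 + pair_e3 w * u ^+ 3
           - pair_e2 w * u ^+ 2 + w`_1 * u - 1.
Proof. by move=> h; rewrite /pair_e2 /pair_e3 esym3E /=; ring: h. Qed.

Lemma chebB_rec n w : chebB n.+3.+3 w =
  w`_1 * chebB n.+3.+2 w - pair_e2 w * chebB n.+4 w + pair_e3 w * chebB n.+3 w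
  - pair_e2 w * chebB n.+2 w + w`_1 * chebB n.+1 w - chebB n w.
Proof.
have [a [b [c [e [h wE AE]]]]] := esym3_surj4 w.
have root (a' b' c' e' : C) : a' * b' * c' * e' = 1 ->
    w = esym3 [tuple a'; b'; c'; e'] ->
    (a' * b') ^+ n.+3.+3 = w`_1 * (a' * b') ^+ n.+3.+2
    - pair_e2 w * (a' * b') ^+ n.+4 + pair_e3 w * (a' * b') ^+ n.+3
    - pair_e2 w * (a' * b') ^+ n.+2 + w`_1 * (a' * b') ^+ n.+1 - (a' * b') ^+ n.
  move=> h' wE'; have -> : n.+3.+3 = (6 + n)%N by [].
  rewrite exprD (pair_root h') -wE' !exprS; ring.
have E (m : nat) : chebB m w = (a * b) ^+ m + (a * c) ^+ m + (a * e) ^+ m +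
    (b * c) ^+ m + (b * e) ^+ m + (c * e) ^+ m.
  by rewrite /chebB AE esym3E /= !exprMn.
rewrite !E {E}.
rewrite (root a b c e) // (root a c b e) ?(root a e b c) ?(root b c a e)
  ?(root b e a c) ?(root c e a b); first by ring.
all: by [rewrite -h; ring | rewrite wE !esym3E; apply: eq3 => /=; ring].
Qed.

Lemma semi_inv_pair_e2 : semi_inv false pair_e2.
Proof. exact: semi_invD semi_inv_p (semi_inv_int (-1)). Qed.

Lemma semi_inv_pair_e3 : semi_inv true pair_e3.
Proof.
have h := semi_invD (semi_invZ 2 semi_inv_m) (semi_invZ (-2) semi_inv_z).
by apply: eq_semi_inv h => w; rewrite /pair_e3 /half_tr; field.
Qed.

(** z and [pair_e3] are odd, [pair_e2] and 1 are even, so the parities alternate. Arbitrary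
    functions in place of [chebB] let this cover Newton's identities as well as the recurrence. *)
Lemma semi_inv_palindrome s F5 F4 F3 F2 F1 F0 :
  semi_inv s F5 -> semi_inv (~~ s) F4 -> semi_inv s F3 ->
  semi_inv (~~ s) F2 -> semi_inv s F1 -> semi_inv (~~ s) F0 ->
  semi_inv (~~ s) (fun w => w`_1 * F5 w - pair_e2 w * F4 w + pair_e3 w * F3 w
    - pair_e2 w * F2 w + w`_1 * F1 w - F0 w).
Proof.
move=> h5 h4 h3 h2 h1 h0.
apply: semi_invD (semi_invN h0); apply: semi_invD (semi_invM semi_inv_z h1).
apply: semi_invD (semi_invN (semi_invM semi_inv_pair_e2 h2)).
apply: semi_invD (semi_invM semi_inv_pair_e3 h3).
exact: semi_invD (semi_invM semi_inv_z h5) (semi_invN (semi_invM semi_inv_pair_e2 h4)).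
Qed.

Lemma semi_inv_chebB n : semi_inv (odd n) (chebB n).
Proof.
have init := chebB_init; have pal := semi_inv_palindrome.
have h0 : semi_inv false (chebB 0).
  by apply: eq_semi_inv (semi_inv_int 6) => w; case: (init w).
have h1 : semi_inv true (chebB 1).
  by apply: eq_semi_inv semi_inv_z => w; case: (init w).
have zero := semi_inv0.
(* Newton's identities of degrees 2 to 5 are truncated palindromes: the degree itself replaces
   [chebB 0], and zeros follow it. *)
have h2 : semi_inv false (chebB 2).
  apply: eq_semi_inv (pal true _ _ _ _ _ _ h1 (semi_inv_int 2)
    (zero _) (zero _) (zero _) (zero _)) => w.
  by case: (init w) => _ _ -> _; ring.
have h3 : semi_inv true (chebB 3).
  apply: eq_semi_inv (pal false _ _ _ _ _ _ h2 h1
    (semi_inv_int 3) (zero _) (zero _) (zero _)) => w.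
  by case: (init w) => _ _ _ [-> _ _]; ring.
have h4 : semi_inv false (chebB 4).
  apply: eq_semi_inv (pal true _ _ _ _ _ _ h3 h2 h1
    (semi_inv_int 4) (zero _) (zero _)) => w.
  by case: (init w) => _ _ _ [_ -> _]; ring.
have h5 : semi_inv true (chebB 5).
  apply: eq_semi_inv (pal false _ _ _ _ _ _ h4 h3 h2 h1
    (semi_inv_int 5) (zero _)) => w.
  by case: (init w) => _ _ _ [_ _ ->]; ring.
suff: [/\ semi_inv (odd n) (chebB n), semi_inv (~~ odd n) (chebB n.+1),
   semi_inv (odd n) (chebB n.+2) &
   [/\ semi_inv (~~ odd n) (chebB n.+3), semi_inv (odd n) (chebB n.+4) &
       semi_inv (~~ odd n) (chebB n.+3.+2)]] by case.
elim: n => [|n [g0 g1 g2 [g3 g4 g5]]] //=; rewrite negbK; split=> //; split=> //.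
have g := pal (~~ odd n); rewrite negbK in g.
apply: eq_semi_inv (g _ _ _ _ _ _ g5 g4 g3 g2 g1 g0) => w.
by rewrite chebB_rec.
Qed.

Lemma graded_monom n a b c (k : int) : (a + b.*2 + 3 * c = n %[mod 4])%N ->
  graded n (fun w => k%:~R * monom a b c w).
Proof.
move=> h; apply: (@gradedS n (fun=> 0) _ a b c k h) => [|w]; last by rewrite addr0.
exact: graded0.
Qed.

(** The coefficients w_0, w_1, w_2 and 1 of the recurrence have weights 1, 2, 3 and 0 = 4 mod 4,
    which match the drops of the index. *)
Lemma graded_chebA n : graded n (chebA n).
Proof.
have h0 : graded 0 (chebA 0).
  apply: eq_graded (@graded_monom 0 0 0 0 4 _) => // w.
  by have [-> _ _ _] := chebA_init w; rewrite /monom !expr0 !mulr1.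
have h1 : graded 1 (chebA 1).
  apply: eq_graded (@graded_monom 1 1 0 0 1 _) => // w.
  by have [_ -> _ _] := chebA_init w; rewrite /monom; ring.
have h2 : graded 2 (chebA 2).
  apply: eq_graded (gradedD (@graded_monom 2 2 0 0 1 _)
    (@graded_monom 2 0 1 0 (-2) _)) => // w.
  by have [_ _ -> _] := chebA_init w; rewrite /monom; ring.
have h3 : graded 3 (chebA 3).
  apply: eq_graded (gradedD (gradedD (@graded_monom 3 3 0 0 1 _)
    (@graded_monom 3 1 1 0 (-3) _))
    (@graded_monom 3 0 0 1 3 _)) => // w.
  by have [_ _ _ ->] := chebA_init w; rewrite /monom; ring.
suff: [/\ graded n (chebA n), graded n.+1 (chebA n.+1),
          graded n.+2 (chebA n.+2) & graded n.+3 (chebA n.+3)] by case.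
elim: n => [|n [g0 g1 g2 g3]] //; split=> //.
have step m (a b c : nat) (k : int) : graded m (chebA m) ->
    (m + (a + b.*2 + 3 * c) = n.+4 %[mod 4])%N ->
    graded n.+4 (fun w => k%:~R * monom a b c w * chebA m w).
  by move=> hm mn; exact: eq_mod_graded mn (gradedM_monom k (erefl _) hm).
have h := gradedD (gradedD (gradedD (step _ 1 0 0 1 g3 _) (step _ 0 1 0 (-1) g2 _))
  (step _ 0 0 1 1 g1 _)) (step _ 0 0 0 (-1) g0 _).
apply: eq_graded (h _ _ _ _); [move=> w|lia..].
by rewrite chebA_rec /monom; ring.
Qed.

End Semiinvariants.

Theorem theorem4p1 (R : realType) (d : nat) (hd : (0 < d)%N) :
  exists Pd Qd Rd Sd : {mpoly int[4]}, forall u : XQ R,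
    [/\ (sval (cheb_g d u))`_0 = evalZ Pd (sval u),
        (sval (cheb_g d u))`_1 = evalZ Qd (sval u),
        (sval (cheb_g d u))`_2 = evalZ Rd (sval u)
      & (sval (cheb_g d u))`_3 = evalZ Sd (sval u)].
Proof.
have hA := graded_chebA R d; have hB := semi_inv_chebB R d.
have hM := graded_half_sqr hA.
have [P PE] := graded_norm hA.
(* Both factors have the parity of d, so each product lies in the even part and is an integral
   polynomial in p, q, r, s. *)
have := semi_invM hB hB; rewrite addbb => -[Q QE].
have := semi_invM hB hM; rewrite addbb => -[T TE].
have := semi_invM hM hM; rewrite addbb => -[S SE].
exists P, Q, T, S => u; have [v <-] := Ftilde_surj u.
have -> : cheb_g d (Ftilde v) = Ftilde (cheb_f d v).
  by rewrite /cheb_g; case: (cheb_g_exists R d) => g /= ->.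
rewrite [sval (Ftilde v)]/= -invM3_M3 -PE -QE -TE -SE !chebA_flip.
rewrite [sval _]/= invD4_M3inv /=.
by split; rewrite ?expr2.
Qed.
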